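(* Let $n\ge1$. The restriction of $\Phi$ to $\mathfrak{S}_n(231)$ is a bijection from $\mathfrak{S}_n(231)$ onto $\mathfrak{S}_n(321)$. Moreover, for $\sigma\in\mathfrak{S}_n(231)$, $$(31\text{-}2,\ \mathsf{des},\ \mathsf{asc}^\infty,\ \mathsf{lda}-\mathsf{fmax},\ \mathsf{ldd},\ \mathsf{lval},\ \mathsf{lpk},\ \mathsf{fmax})\,\sigma=(\mathsf{icr},\ \mathsf{drop},\ \mathsf{exc}+\mathsf{fix},\ \mathsf{cda},\ \mathsf{cdd},\ \mathsf{cval},\ \mathsf{cpk},\ \mathsf{fix})\,\Phi(\sigma)$$ $$=(\mathsf{cros},\ \mathsf{exc},\ \mathsf{drop}+\mathsf{fix},\ \mathsf{cdd},\ \mathsf{cda},\ \mathsf{cval},\ \mathsf{cpk},\ \mathsf{fix})\,(\Phi(\sigma))^{-1}.$$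
   Context: The map $\Phi:\mathfrak{S}_n\to\mathfrak{S}_n$: for $\rho\in\mathfrak{S}_n$, a letter $\rho(i)$ is a descent top if $i\le n-1$ and $\rho(i)>\rho(i+1)$, a descent bottom if $i\ge2$ and $\rho(i-1)>\rho(i)$; otherwise a nondescent top (resp. bottom). For $x=\rho(i)$ let $c(x)=\#\{j:i<j<n,\ \rho(j+1)<x<\rho(j)\}$. Let $f$ (resp. $g$) be the increasing word of descent bottoms (resp. nondescent bottoms); $f'$ the arrangement of the descent tops in which each letter $x$ has exactly $c(x)$ larger letters to its left; $g'$ the arrangement of the nondescent tops in which each letter $x$ has exactly $c(x)$ smaller letters to its right. With the two-row array of top row $fg$ and bottom row $f'g'$, $\Phi(\rho)=\tau$ with $\tau(b)=a$ for each column (top $a$, bottom $b$). Statistics of $\sigma$: $(31\text{-}2)\sigma=\#\{(i,j):i+1<j\le n,\ \sigma(i+1)<\sigma(j)<\sigma(i)\}$; $\mathsf{des}\,\sigma=\#\{i\in[n-1]:\sigma(i)>\sigma(i+1)\}$; $\mathsf{asc}^\infty\sigma=\#\{i\in[n]:\sigma(i)<\sigma(i+1)\}$ with $\sigma(n+1)=\infty$ (i.e. $n-\mathsf{des}\,\sigma$). With convention $\sigma(0)=0,\sigma(n+1)=\infty$: $\mathsf{lpk},\mathsf{lval},\mathsf{lda},\mathsf{ldd}$ count $i\in[n]$ with $\sigma(i-1)<\sigma(i)>\sigma(i+1)$, $\sigma(i-1)>\sigma(i)<\sigma(i+1)$, $\sigma(i-1)<\sigma(i)<\sigma(i+1)$,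 $\sigma(i-1)>\sigma(i)>\sigma(i+1)$ respectively; $\mathsf{fmax}$ counts such double ascents that are left-to-right maxima. Statistics of $\pi$: $\mathsf{exc},\mathsf{drop},\mathsf{fix}$ count $i$ with $\pi(i)>i$, $\pi(i)<i$, $\pi(i)=i$; $\mathsf{cpk},\mathsf{cval},\mathsf{cda},\mathsf{cdd}$ count values $x$ with $\pi^{-1}(x)<x>\pi(x)$, $\pi^{-1}(x)>x<\pi(x)$, $\pi^{-1}(x)<x<\pi(x)$, $\pi^{-1}(x)>x>\pi(x)$; $\mathsf{cros}\,\pi=\sum_i\#\{j:j<i<\pi(j)<\pi(i)\text{ or }\pi(i)<\pi(j)\le i<j\}$ and $\mathsf{icr}\,\pi=\mathsf{cros}\,\pi^{-1}$. *)

(* Defs.v *)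
(* Permutations of [n] = {1,...,n} are represented
   as words (seq nat) in one-line notation: sigma(i) = nth 0 s (i-1). *)
From mathcomp Require Import all_boot.

Set Implicit Arguments.
Unset Strict Implicit.
Unset Printing Implicit Defensive.

Definition val_at (s : seq nat) (i : nat) : nat := nth 0 s i.-1.

(* extended access with s(0) = 0 and s(n+1) = infinity (encoded as n+1,
   which exceeds every letter of a permutation of [n]) *)
Definition ext_at (s : seq nat) (i : nat) : nat :=
  if i == 0 then 0 else if size s < i then (size s).+1 else val_at s i.

(* position of letter x in s (1-based); for a permutation this is s^{-1}(x) *)
Definition pos (s : seq nat) (x : nat) : nat := (index x s).+1.

Definition is_perm (n : nat) (s : seq nat) : bool := perm_eq s (iota 1 n).

Definition invp (p : seq nat) : seq nat := [seq pos p x | x <- iota 1 (size p)].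

Definition avoids231 (s : seq nat) : bool :=
  ~~ has (fun i => has (fun j => has (fun k =>
        (val_at s k < val_at s i) && (val_at s i < val_at s j))
      (iota j.+1 (size s - j))) (iota i.+1 (size s - i))) (iota 1 (size s)).

Definition avoids321 (s : seq nat) : bool :=
  ~~ has (fun i => has (fun j => has (fun k =>
        (val_at s k < val_at s j) && (val_at s j < val_at s i))
      (iota j.+1 (size s - j))) (iota i.+1 (size s - i))) (iota 1 (size s)).

Section PhiDef.
Variable r : seq nat.

Definition is_desc_top (x : nat) : bool :=
  let i := pos r x in (i <= (size r).-1) && (val_at r i.+1 < x).

Definition is_desc_bot (x : nat) : bool :=
  let i := pos r x in (2 <= i) && (x < val_at r i.-1).

Definition cstat (x : nat) : nat :=
  let i := pos r x in
  count (fun j => (val_at r j.+1 < x) && (x < val_at r j))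
        (iota i.+1 ((size r).-1 - i)).

Definition phi_f : seq nat := sort leq [seq x <- r | is_desc_bot x].
Definition phi_g : seq nat := sort leq [seq x <- r | ~~ is_desc_bot x].

Definition phi_f' : seq nat :=
  head [::] [seq t <- permutations [seq x <- r | is_desc_top x] |
     all (fun x => count (fun y => x < y) (take (index x t) t) == cstat x) t].

Definition phi_g' : seq nat :=
  head [::] [seq t <- permutations [seq x <- r | ~~ is_desc_top x] |
     all (fun x => count (fun y => y < x) (drop (index x t).+1 t) == cstat x) t].

End PhiDef.

(* top row f g, bottom row f' g'; tau(b) = a for each column (a over b) *)
Definition Phi (r : seq nat) : seq nat :=
  let top := phi_f r ++ phi_g r in
  let bot := phi_f' r ++ phi_g' r in
  [seq nth 0 top (index b bot) | b <- iota 1 (size r)].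

Definition st_31_2 (s : seq nat) : nat :=
  sumn [seq count (fun j => (val_at s i.+1 < val_at s j) && (val_at s j < val_at s i))
                 (iota i.+2 (size s - i.+1)) | i <- iota 1 (size s)].

Definition st_des (s : seq nat) : nat :=
  count (fun i => val_at s i.+1 < val_at s i) (iota 1 (size s).-1).

Definition st_ascinf (s : seq nat) : nat :=
  count (fun i => ext_at s i < ext_at s i.+1) (iota 1 (size s)).

Definition st_lpk (s : seq nat) : nat :=
  count (fun i => (ext_at s i.-1 < ext_at s i) && (ext_at s i > ext_at s i.+1))
        (iota 1 (size s)).
Definition st_lval (s : seq nat) : nat :=
  count (fun i => (ext_at s i.-1 > ext_at s i) && (ext_at s i < ext_at s i.+1))
        (iota 1 (size s)).
Definition st_lda (s : seq nat) : nat :=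
  count (fun i => (ext_at s i.-1 < ext_at s i) && (ext_at s i < ext_at s i.+1))
        (iota 1 (size s)).
Definition st_ldd (s : seq nat) : nat :=
  count (fun i => (ext_at s i.-1 > ext_at s i) && (ext_at s i > ext_at s i.+1))
        (iota 1 (size s)).

Definition st_fmax (s : seq nat) : nat :=
  count (fun i => [&& ext_at s i.-1 < ext_at s i, ext_at s i < ext_at s i.+1
                    & all (fun j => val_at s j < val_at s i) (iota 1 i.-1)])
        (iota 1 (size s)).

Definition st_exc (p : seq nat) : nat :=
  count (fun i => i < val_at p i) (iota 1 (size p)).
Definition st_drop (p : seq nat) : nat :=
  count (fun i => val_at p i < i) (iota 1 (size p)).
Definition st_fix (p : seq nat) : nat :=
  count (fun i => val_at p i == i) (iota 1 (size p)).

Definition st_cpk (p : seq nat) : nat :=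
  count (fun x => (pos p x < x) && (x > val_at p x)) (iota 1 (size p)).
Definition st_cval (p : seq nat) : nat :=
  count (fun x => (pos p x > x) && (x < val_at p x)) (iota 1 (size p)).
Definition st_cda (p : seq nat) : nat :=
  count (fun x => (pos p x < x) && (x < val_at p x)) (iota 1 (size p)).
Definition st_cdd (p : seq nat) : nat :=
  count (fun x => (pos p x > x) && (x > val_at p x)) (iota 1 (size p)).

Definition st_cros (p : seq nat) : nat :=
  sumn [seq count (fun j =>
      [&& j < i, i < val_at p j & val_at p j < val_at p i]
      || [&& val_at p i < val_at p j, val_at p j <= i & i < j])
    (iota 1 (size p)) | i <- iota 1 (size p)].

Definition st_icr (p : seq nat) : nat := st_cros (invp p).

(* Main.v *)
Require Import Defs.
From mathcomp Require Import all_boot zify.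

(* When s avoids 231 every c(x) vanishes, so that t = Phi s maps the descent tops T of s
   increasingly onto the descent bottoms B, and the complement of T increasingly onto
   the complement of B. For each letter x, the number of elements of B below x exceeds
   the number of elements of T up to x by the number d(x) of descents of s that pass
   over x. Hence T is the set of drop positions of t, a fixed point is a letter outside
   T and B with d(x) = 0, and d(x) is the contribution of x both to 31-2 (all descents
   passing over x precede it) and to the crossings of the inverse of t.
   Conversely a 321-avoiding permutation is increasing on its drops and on its
   non-drops. A 231-avoiding permutation is rebuilt from (T, B) by inserting the letters
   in increasing order: the blocks already built are kept in a stack, and only the
   topmost blocks can receive the next letter. *)

Set Implicit Arguments.
Unset Strict Implicit.
Unset Printing Implicit Defensive.

(** * Counting over initial segments *)

Lemma mem_iota1 n x : (x \in iota 1 n) = (0 < x <= n).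
Proof. by rewrite mem_iota add1n ltnS. Qed.

Lemma eq_in_count1 n (P Q : pred nat) : (forall i, 0 < i <= n -> P i = Q i) ->
  count P (iota 1 n) = count Q (iota 1 n).
Proof. by move=> H; apply: eq_in_count => i; rewrite mem_iota1; apply: H. Qed.

Lemma count_addE (l : seq nat) (P Q R : pred nat) :
  (forall i, i \in l -> P i = Q i + R i :> nat) -> count P l = count Q l + count R l.
Proof.
elim: l => //= a l IH H; rewrite IH => [|i Hi]; last by rewrite H // inE Hi orbT.
by rewrite H ?inE ?eqxx // addnACA.
Qed.

Lemma count_iota0 (P : pred nat) n : count P (iota 0 n.+1) = P 0 + count P (iota 1 n).
Proof. by []. Qed.

Lemma count_iotaS (P : pred nat) m n :
  count P (iota m n.+1) = count P (iota m n) + P (m + n).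
Proof. by rewrite -addn1 iotaD count_cat /= addn0. Qed.

Lemma count_pred (P : pred nat) x : 0 < x ->
  count P (iota 1 x) = count P (iota 1 x.-1) + P x.
Proof. by case: x => // x _; rewrite count_iotaS. Qed.

Lemma count_iota_le n m (P : pred nat) : m <= n ->
  count (fun x => P x && (x <= m)) (iota 1 n) = count P (iota 1 m).
Proof.
move=> Hm; rewrite -(subnKC Hm) iotaD count_cat.
rewrite [X in _ + X](_ : _ = 0) ?addn0.
  by apply: eq_in_count => x; rewrite mem_iota => Hx; rewrite (_ : x <= m) ?andbT //; lia.
apply/eqP; rewrite -leqn0 leqNgt -has_count; apply/hasPn => x; rewrite mem_iota => Hx.
by rewrite (_ : x <= m = false) ?andbF //; lia.
Qed.

Lemma count_iota_lip (P : pred nat) m k : m <= k ->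
  count P (iota 1 m) <= count P (iota 1 k) <= count P (iota 1 m) + (k - m).
Proof.
move=> mk; rewrite -(subnKC mk) iotaD count_cat leq_addr leq_add2l addKn.
by rewrite (leq_trans (count_size _ _)) ?size_iota.
Qed.

Lemma count_iota_predC (P : pred nat) k :
  count (predC P) (iota 1 k) = k - count P (iota 1 k).
Proof. by rewrite -[X in _ = X - _](size_iota 1 k) -(count_predC P) addKn. Qed.

(** * Permutations in one-line notation *)

Lemma is_perm_size n s : is_perm n s -> size s = n.
Proof. by move/perm_size; rewrite size_iota. Qed.

Lemma is_perm_uniq n s : is_perm n s -> uniq s.
Proof. by move/perm_uniq=> ->; apply: iota_uniq. Qed.

Lemma is_perm_mem n s x : is_perm n s -> (x \in s) = (0 < x <= n).
Proof. by move/perm_mem=> ->; rewrite mem_iota add1n ltnS. Qed.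

Lemma val_at_in n s i : is_perm n s -> 0 < i <= n -> 0 < val_at s i <= n.
Proof.
move=> ps Hi; rewrite -(is_perm_mem _ ps) /val_at mem_nth // (is_perm_size ps); lia.
Qed.

Lemma val_atK n s i : is_perm n s -> 0 < i <= n -> pos s (val_at s i) = i.
Proof.
move=> ps Hi; rewrite /pos /val_at index_uniq ?(is_perm_uniq ps) ?(is_perm_size ps); lia.
Qed.

Lemma posK n s x : is_perm n s -> 0 < x <= n -> val_at s (pos s x) = x.
Proof. by move=> ps Hx; rewrite /val_at /pos /= nth_index // (is_perm_mem _ ps). Qed.

Lemma pos_in n s x : is_perm n s -> 0 < x <= n -> 0 < pos s x <= n.
Proof.
by move=> ps; rewrite -(is_perm_mem _ ps) -index_mem (is_perm_size ps) /pos.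
Qed.

Lemma val_at_inj n s i j : is_perm n s -> 0 < i <= n -> 0 < j <= n ->
  val_at s i = val_at s j -> i = j.
Proof. by move=> ps Hi Hj e; rewrite -(val_atK ps Hi) e (val_atK ps Hj). Qed.

Lemma map_val_at s : map (val_at s) (iota 1 (size s)) = s.
Proof.
apply: (@eq_from_nth _ 0); rewrite size_map size_iota // => i Hi.
by rewrite (nth_map 0) ?size_iota // nth_iota.
Qed.

Lemma count_val_at n s (P : nat -> nat -> bool) : is_perm n s ->
  count (fun i => P i (val_at s i)) (iota 1 n) =
  count (fun x => P (pos s x) x) (iota 1 n).
Proof.
move=> ps; rewrite -[RHS](permP ps) -[X in _ = count _ X]map_val_at count_map (is_perm_size ps).
by apply: eq_in_count => i; rewrite mem_iota add1n ltnS => Hi /=; rewrite (val_atK ps).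
Qed.

Lemma size_invp p : size (invp p) = size p.
Proof. by rewrite size_map size_iota. Qed.

Lemma val_at_invp n p x : is_perm n p -> 0 < x <= n -> val_at (invp p) x = pos p x.
Proof.
move=> pp Hx; rewrite /val_at (nth_map 0) ?size_iota ?(is_perm_size pp); last lia.
rewrite nth_iota; [congr pos|]; lia.
Qed.

Lemma is_perm_invp n p : is_perm n p -> is_perm n (invp p).
Proof.
move=> pp; have e := is_perm_size pp.
have H x : (x \in iota 1 n) = (0 < x <= n) by rewrite mem_iota add1n ltnS.
have U : uniq (invp p).
  rewrite map_inj_in_uniq ?iota_uniq // => x y; rewrite e !H => Hx Hy exy.
  by rewrite -(posK pp Hx) exy (posK pp Hy).
apply: uniq_perm => //; first exact: iota_uniq.
have S : {subset invp p <= iota 1 n}; last first.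
  by case: (uniq_min_size U S) => //; rewrite size_iota size_invp e.
by move=> _ /mapP[x Hx ->]; move: Hx; rewrite e !H; apply: pos_in.
Qed.

Lemma pos_invp n p x : is_perm n p -> 0 < x <= n -> pos (invp p) x = val_at p x.
Proof.
move=> pp Hx; have Hv := val_at_in pp Hx; have pi := is_perm_invp pp.
by rewrite -[in LHS](val_atK pp Hx) -(val_at_invp pp Hv) (val_atK pi).
Qed.

Lemma avoids231P s : reflect (forall i j k, 0 < i -> i < j -> j < k -> k <= size s ->
    val_at s k < val_at s i -> val_at s i < val_at s j -> False) (avoids231 s).
Proof.
apply: (iffP idP) => [/hasPn H i j k Hi Hij Hjk Hk H1 H2|H].
  have Ii : i \in iota 1 (size s) by rewrite mem_iota; lia.
  have /hasPn/(_ j) {H} := H i Ii; rewrite mem_iota => /(_ ltac:(lia))/hasPn/(_ k).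
  by rewrite mem_iota H1 H2 => /(_ ltac:(lia)).
apply/hasPn => i; rewrite mem_iota => Hi; apply/hasPn => j; rewrite mem_iota => Hj.
apply/hasPn => k; rewrite mem_iota => Hk; apply/negP => /andP[H1 H2].
by apply: (H i j k) => //; lia.
Qed.

Lemma avoids321P s : reflect (forall i j k, 0 < i -> i < j -> j < k -> k <= size s ->
    val_at s k < val_at s j -> val_at s j < val_at s i -> False) (avoids321 s).
Proof.
apply: (iffP idP) => [/hasPn H i j k Hi Hij Hjk Hk H1 H2|H].
  have Ii : i \in iota 1 (size s) by rewrite mem_iota; lia.
  have /hasPn/(_ j) {H} := H i Ii; rewrite mem_iota => /(_ ltac:(lia))/hasPn/(_ k).
  by rewrite mem_iota H1 H2 => /(_ ltac:(lia)).
apply/hasPn => i; rewrite mem_iota => Hi; apply/hasPn => j; rewrite mem_iota => Hj.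
apply/hasPn => k; rewrite mem_iota => Hk; apply/negP => /andP[H1 H2].
by apply: (H i j k) => //; lia.
Qed.

(** * Rebuilding a 231-avoiding word from its descent tops and bottoms *)

(** Each letter in turn is tested as the 2 of a pattern 231; this recursive form behaves well under
    concatenation. *)
Fixpoint av (w : seq nat) : bool :=
  if w is a :: w' then
    pairwise (fun y z => ~~ ((z < a) && (a < y))) w' && av w'
  else true.

Fixpoint dtop (w : seq nat) : seq nat :=
  if w is a :: w' then
    (if w' is b :: _ then if b < a then [:: a] else [::] else [::]) ++ dtop w'
  else [::].

(** [p] is the letter that precedes [w]. *)
Fixpoint dbot_from (p : nat) (w : seq nat) : seq nat :=
  if w is a :: w' then (if a < p then [:: a] else [::]) ++ dbot_from a w' else [::].

(* In an open block all letters still to come are larger than w, so that the letter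
   preceding w in the final word is larger than the first letter of w. *)
Definition dbot (w : seq nat) : seq nat :=
  if w is a :: w' then a :: dbot_from a w' else [::].

(** The maximum [x] can only be the 3 of a 231, which forbids a letter of [v] below a letter of [u];
    once [u] lies below [v], no other pattern straddles [x]. *)
Lemma av_max u x v : uniq (u ++ v) -> all (ltn^~ x) u -> all (ltn^~ x) v ->
  av (u ++ x :: v) = [&& av u, av v & allrel ltn u v].
Proof.
elim: u => [|a u IH] /=.
  move=> _ _ Hv; rewrite allrel0l andbT; case: (av v); rewrite ?andbF // andbT.
  apply/(pairwiseP 0) => i j Hi Hj _; rewrite negb_and orbC -leqNgt.
  by move/(all_nthP 0)/(_ i Hi): Hv => /ltnW ->.
move=> /andP[Ha U] /andP[Hax Hu] Hv; rewrite IH // allrel_consl pairwise_cat allrel_consr /=.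
have -> : all (fun y => ~~ ((y < a) && (a < x))) v = all (ltn a) v.
  apply: eq_in_all => z Hz; rewrite Hax andbT -leqNgt leq_eqVlt.
  by case: eqP => // e; rewrite e mem_cat Hz orbT in Ha.
have -> : all (fun y => ~~ ((x < a) && (a < y))) u.
  by apply/allP => y Hy; rewrite ltnNge (ltnW Hax).
case: (boolP (all (ltn a) v)) => Hav; rewrite ?andbF //=.
have -> : pairwise (fun y z => ~~ ((z < a) && (a < y))) v.
  apply/(pairwiseP 0) => i j Hi Hj _; rewrite negb_and -leqNgt.
  by apply/orP; left; move/(all_nthP 0)/(_ j Hj): Hav => /ltnW.
have -> : allrel (fun y z => ~~ ((z < a) && (a < y))) u v.
  apply/allrelP => y z _ Hz; rewrite negb_and -leqNgt.
  by apply/orP; left; move/allP/(_ z Hz): Hav => /ltnW.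
by rewrite /= andbT !andbA.
Qed.

Lemma dtop_max u x v : all (ltn^~ x) u -> all (ltn^~ x) v ->
  dtop (u ++ x :: v) = dtop u ++ (if v is [::] then [::] else [:: x]) ++ dtop v.
Proof.
move=> Hu Hv; elim: u Hu => [|a u IH] /= => [_|/andP[Ha Hu]].
  by case: v Hv => [|b v] //= /andP[-> _].
rewrite IH // -catA; congr (_ ++ _).
by case: u {IH Hu} => //=; rewrite ltnNge (ltnW Ha).
Qed.

Lemma dbot_from_max x v : all (ltn^~ x) v -> dbot_from x v = dbot v.
Proof. by case: v => //= a v /andP[-> _]. Qed.

Lemma dbot_max u x v : all (ltn^~ x) u -> all (ltn^~ x) v ->
  dbot (u ++ x :: v) = dbot u ++ (if u is [::] then [:: x] else [::]) ++ dbot v.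
Proof.
move=> Hu Hv; case: u Hu => [_|a u /andP[/= Ha Hu]] /=; first by rewrite dbot_from_max.
congr cons; elim: u a Ha Hu => [|b u IH] a Ha /=; last by case/andP=> *; rewrite IH // catA.
by rewrite ltnNge (ltnW Ha) dbot_from_max.
Qed.

Lemma sub_dtop w : {subset dtop w <= w}.
Proof.
elim: w => //= a w IH y; rewrite mem_cat inE => /orP[|/IH ->]; last by rewrite orbT.
by case: w {IH} => // b w; case: ifP => // _; rewrite inE => ->.
Qed.

Lemma sub_dbot w : {subset dbot w <= w}.
Proof.
case: w => //= a w y; rewrite !inE => /orP[->//|H]; apply/orP; right.
elim: w a H => //= b w IH a; rewrite mem_cat inE => /orP[|/IH ->]; last by rewrite orbT.
by case: ifP => //; rewrite inE => _ ->.
Qed.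

(* After the letters 0, ..., x - 1 have been treated, st lists (rightmost first) the
   maximal blocks of the final word formed by these letters. Avoiding 231 forces the
   new letter x to be placed at the rightmost block: it is glued to the block on its
   right when it is a descent top, and to the one on its left when it is not a descent
   bottom. *)
Definition pop (b : bool) (st : seq (seq nat)) : seq nat * seq (seq nat) :=
  if b then (head [::] st, behead st) else ([::], st).

Definition step (T B : pred nat) (st : seq (seq nat)) (x : nat) : seq (seq nat) :=
  let: (v, st1) := pop (T x) st in
  let: (u, st2) := pop (~~ B x) st1 in
  (u ++ x :: v) :: st2.

Definition run (T B : pred nat) (n : nat) : seq (seq nat) :=
  foldl (step T B) [::] (iota 0 n).

Lemma runS T B n : run T B n.+1 = step T B (run T B n) n.
Proof. by rewrite /run -addn1 iotaD foldl_cat. Qed.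

(** Blocks further down the stack stand further left and must hold smaller letters: a larger letter
    will separate two blocks, and would otherwise be the 3 of a 231. *)
Definition good (n : nat) (st : seq (seq nat)) : bool :=
  [&& perm_eq (flatten st) (iota 0 n),
      pairwise (fun b c => allrel ltn c b) st & all av st].

Definition tops (st : seq (seq nat)) := flatten (map dtop st).
Definition bots (st : seq (seq nat)) := flatten (map dbot st).

(** An empty block stands for a side on which nothing was glued; it is never kept in the stack. *)
Definition push_nonempty (b : seq nat) (st : seq (seq nat)) :=
  if b is [::] then st else b :: st.

Lemma good_push n b st : good n (push_nonempty b st) = good n (b :: st).
Proof.
by case: b => //=; rewrite /good /=; congr (_ && (_ && _)); 
   rewrite [X in _ = X && _](_ : _ = true) //; apply/allP => c _; rewrite allrel0r.
Qed.

Lemma good_push2 n b c st : good n (b :: push_nonempty c st) = good n (b :: c :: st).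
Proof.
case: c => //=; rewrite /good /=; do !congr (_ && _).
by rewrite [X in _ = X && _](_ : _ = true) //; apply/allP => c _; rewrite allrel0r.
Qed.

(** By [av_max], avoidance in the glued block asks [u] to lie below [v], which is the order the
    stack already imposes. The equality serves both to build words and to take them apart. *)
Lemma good_step n u v st :
  good n.+1 ((u ++ n :: v) :: st) = good n (v :: u :: st).
Proof.
have E : perm_eq (flatten ((u ++ n :: v) :: st)) (iota 0 n.+1) =
         perm_eq (flatten (v :: u :: st)) (iota 0 n).
  have p1 : perm_eq (flatten ((u ++ n :: v) :: st)) (n :: flatten (v :: u :: st)).
    by apply/permP => P; rewrite /= !count_cat /=; lia.
  have p2 : perm_eq (iota 0 n.+1) (n :: iota 0 n).
    by rewrite -addn1 iotaD -[n :: _]cat1s perm_catC.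
  by rewrite (permPl p1) (permPr p2) perm_cons.
rewrite /good E; case: (boolP (perm_eq _ _)) => //= P.
have L y : y \in v ++ u ++ flatten st -> y < n.
  by rewrite (perm_mem P) mem_iota.
have /= U := perm_uniq P; rewrite iota_uniq catA cat_uniq in U.
have Uuv : uniq (u ++ v) by rewrite uniq_catC; case/andP: U.
rewrite av_max //; last 2 first.
- by apply/allP => y Hy; apply: L; rewrite !mem_cat Hy orbT.
- by apply/allP => y Hy; apply: L; rewrite !mem_cat Hy.
have -> : all (fun c => allrel ltn c (u ++ n :: v)) st =
   all (fun c => allrel ltn c v) st && all (fun c => allrel ltn c u) st.
  rewrite -all_predI; apply: eq_in_all => c Hc /=.
  rewrite allrel_catr allrel_consr (_ : all (ltn^~ n) c) 1?andbC //.
  apply/allP => y Hy; apply: L; rewrite !mem_cat; apply/orP; right; apply/orP; right.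
  by apply/flattenP; exists c.
move: (all _ _) (all _ _) (pairwise _ _) (all _ _) (allrel _ _ _) (av _) (av _).
by do 7!case.
Qed.

Lemma pop_push b v st : (v == [::]) = ~~ b ->
  pop b (push_nonempty v st) = (v, st).
Proof. by case: b; case: v. Qed.

(** Gluing leaves the status of older letters unchanged: the last letter of [u] was not a top and is
    now followed by a larger letter. *)
Lemma mem_tops_step n u v st y : good n (v :: u :: st) ->
  (y \in tops ((u ++ n :: v) :: st)) =
  (y == n) && (v != [::]) || (y \in tops (push_nonempty v (push_nonempty u st))).
Proof.
case/and3P=> P _ _; have L z : z \in v ++ u ++ flatten st -> z < n.
  by rewrite (perm_mem P) mem_iota.
rewrite /tops /= dtop_max; last 2 first.
- by apply/allP => z Hz; apply: L; rewrite !mem_cat Hz orbT.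
- by apply/allP => z Hz; apply: L; rewrite !mem_cat Hz.
by case: u v {L P} => [|a u] [|b v]; rewrite /= ?mem_cat ?inE ?mem_cat ?andbF ?andbT ?orbF //=;
  do !case: (_ \in _); rewrite ?orbT ?orbF.
Qed.

(** The head of [v] was a bottom by convention and remains one because it now follows [n]. *)
Lemma mem_bots_step n u v st y : good n (v :: u :: st) ->
  (y \in bots ((u ++ n :: v) :: st)) =
  (y == n) && (u == [::]) || (y \in bots (push_nonempty v (push_nonempty u st))).
Proof.
case/and3P=> P _ _; have L z : z \in v ++ u ++ flatten st -> z < n.
  by rewrite (perm_mem P) mem_iota.
rewrite /bots /= dbot_max; last 2 first.
- by apply/allP => z Hz; apply: L; rewrite !mem_cat Hz orbT.
- by apply/allP => z Hz; apply: L; rewrite !mem_cat Hz.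
case: u v {L P} => [|a u] [|b v]; rewrite /= ?mem_cat ?inE ?mem_cat ?andbF ?andbT ?orbF //=.
rewrite !inE mem_cat !orbA; move: (y == a) (y == b) (y \in _) (y \in _) (y \in _).
by do 5!case.
Qed.

Lemma tops_lt n st y : good n st -> y \in tops st -> y < n.
Proof.
case/and3P=> P _ _ /flattenP[_ /mapP[b Hb ->] /sub_dtop Hy].
have: y \in flatten st by apply/flattenP; exists b.
by rewrite (perm_mem P) mem_iota.
Qed.

Lemma bots_lt n st y : good n st -> y \in bots st -> y < n.
Proof.
case/and3P=> P _ _ /flattenP[_ /mapP[b Hb ->] /sub_dbot Hy].
have: y \in flatten st by apply/flattenP; exists b.
by rewrite (perm_mem P) mem_iota.
Qed.

(** The topmost block lies above all others, so it contains the largest letter. *)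
Lemma good_last n st : good n.+1 st -> [::] \notin st ->
  exists u v st', [/\ st = (u ++ n :: v) :: st', [::] \notin st' & good n (v :: u :: st')].
Proof.
case: st => [|b st] G; first by case/and3P: G.
rewrite inE negb_or eq_sym => /andP[Hb Hst].
have Hn : n \in b.
  case/and3P: G => P /= /andP[A _] _.
  have: n \in b ++ flatten st by rewrite (perm_mem P) mem_iota; lia.
  rewrite mem_cat => /orP[//|/flattenP[c Hc Hnc]].
  case: b Hb P A => // y b _ P /allP/(_ c Hc)/allrelP/(_ n y Hnc).
  rewrite inE eqxx => /(_ isT) H.
  have: y \in flatten ((y :: b) :: st) by rewrite /= inE eqxx.
  by rewrite (perm_mem P) mem_iota; lia.
case/splitPr: Hn G => u v; rewrite good_step => G.
by exists u, v, st.
Qed.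

Lemma push_nonemptyN b st : [::] \notin st -> [::] \notin push_nonempty b st.
Proof. by case: b => //= a b; rewrite inE. Qed.

(** Uniqueness, by undoing the last gluing: whether the largest letter is a top or a bottom tells
    which of [u] and [v] is empty, hence what the last step popped. *)
Lemma run_good n st T B : good n st -> [::] \notin st ->
  (forall y, y < n -> T y = (y \in tops st)) ->
  (forall y, y < n -> B y = (y \in bots st)) -> run T B n = st.
Proof.
elim: n st => [|n IH] st G Nst HT HB.
  case: st G Nst {HT HB} => // b st /and3P[/perm_size /=].
  by rewrite size_cat; case: b.
have [u [v [st' [e Nst' G']]]] := good_last G Nst.
have G2 : good n (push_nonempty v (push_nonempty u st')) by rewrite good_push good_push2.
have Tn : T n = (v != [::]).
  rewrite HT // e (mem_tops_step _ G') eqxx /=; case: (v != [::]) => //=.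
  by apply/negP => /(tops_lt G2); rewrite ltnn.
have Bn : B n = (u == [::]).
  rewrite HB // e (mem_bots_step _ G') eqxx /=; case: (u == [::]) => //=.
  by apply/negP => /(bots_lt G2); rewrite ltnn.
rewrite runS (IH _ G2); first by rewrite /step !pop_push ?Tn ?Bn ?negbK.
- by rewrite !push_nonemptyN.
- by move=> y Hy; rewrite HT ?leqW // e (mem_tops_step _ G') ltn_eqF.
- by move=> y Hy; rewrite HB ?leqW // e (mem_bots_step _ G') ltn_eqF.
Qed.

Lemma pop_spec (b : bool) st : b <= size st -> [::] \notin st ->
  exists v st1, [/\ pop b st = (v, st1), st = push_nonempty v st1,
    (v == [::]) = ~~ b, [::] \notin st1 & size st = size st1 + b].
Proof.
case: b => /= [|_]; last by exists [::], st; rewrite addn0.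
case: st => //= a st _; rewrite inE negb_or => /andP[Ha Hst].
exists a, st; rewrite eq_sym (negbTE Ha) addn1; split => //.
by case: a Ha.
Qed.

Lemma last_push b st : st != [::] -> last [::] (push_nonempty b st) = last [::] st.
Proof. by case: b; case: st. Qed.

(** Existence: the height of the stack is the surplus of [B] over [T] among the letters treated, so
    the hypothesis on counts guarantees enough blocks to pop. The letter 0 is a sentinel that stays
    at the far left. *)
Lemma run_inv (T B : pred nat) n : T 0 = false -> B 0 ->
  (forall x, 0 < x <= n -> count T (iota 1 x) <= count B (iota 1 x.-1)) ->
  forall x, x <= n.+1 -> let st := run T B x in
  [/\ good x st, [::] \notin st,
      forall y, y < x -> (T y = (y \in tops st)) /\ (B y = (y \in bots st)),
      0 < x -> head 1 (last [::] st) = 0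
    & size st + count T (iota 0 x) = count B (iota 0 x)].
Proof.
move=> T0 B0 H; elim => [//|x IH] Hx /=.
have [G N TB L S] := IH (ltnW Hx); rewrite runS.
set st := run T B x in G N TB L S *.
(* Since [B] also counts 0, one block remains besides the one glued to the right of [x]. *)
have S0 : 0 < x -> T x + 1 <= size st.
  move: (size st) S => m; case: x H Hx {IH st G N TB L} => [//|x] H Hx S _.
  have := H x.+1 Hx; move: S; rewrite !count_iota0 T0 B0 count_iotaS [_.+1.-1]/= add1n; lia.
have S1 : T x + ~~ B x <= size st.
  by case: (posnP x) S0 => [->|xp /(_ isT)]; rewrite ?T0 ?B0 //; case: (B x); lia.
have [v [st1 [pv ev Tv N1 s1]]] := pop_spec (leq_trans (leq_addr _ _) S1) N.
rewrite s1 addnC leq_add2r in S1.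
have [u [st2 [pu eu Bu N2 s2]]] := pop_spec S1 N1.
rewrite /step pv pu.
have G2 : good x (v :: u :: st2) by rewrite -good_push2 -good_push -eu -ev.
split.
- by rewrite good_step.
- by rewrite inE negb_or N2 andbT; case: (u).
- move=> y; rewrite ltnS leq_eqVlt (mem_tops_step _ G2) (mem_bots_step _ G2) -eu -ev.
  case: eqP => [-> _|_ /= Hy]; last by rewrite -!(TB y Hy).1 -!(TB y Hy).2.
  rewrite Tv Bu !negbK /=; split; [case: (T x) => //=|case: (B x) => //=]; apply/esym/negP.
    by move/(tops_lt G); rewrite ltnn.
  by move/(bots_lt G); rewrite ltnn.
- move=> _; case: (posnP x) => [x0|xp].
    have : size st = 0 by rewrite /st x0.
    rewrite s1 s2 => /eqP; rewrite !addn_eq0 -!andbA => /and3P[/nilP -> _].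
    by rewrite x0 in Bu *; rewrite B0 in Bu; move/eqP: Bu => ->.
  have Lx := L xp.
  (* If nothing remains below the new block, [S0] forces [u] to be nonempty, and [u] is then the
     block that starts with 0. *)
  case: (altP (st2 =P [::])) => [e2|n2]; last first.
    have n1 : st1 != [::] by rewrite eu; case: (u).
    by move: Lx; rewrite ev last_push // eu last_push //; case: (st2) n2.
  have := S0 xp; rewrite s1 s2 e2 /= => S3.
  case: u Bu pu eu G2 S3 => [|a u] Bu _ eu _ S3.
    by move: S3; case: (B x) Bu => //= _; case: (T x).
  by move: Lx; rewrite ev last_push eu e2.
- rewrite -!count_iota0 !count_iotaS !add0n -S s1 s2 /=.
  by move: (size st2) (count T _) (T x) (B x) => a b [] []; clear; lia.
Qed.

(** * Permutations as single blocks behind a sentinel 0 *)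

Lemma avP w : reflect (forall i j k, i < j -> j < k -> k < size w ->
    nth 0 w k < nth 0 w i -> nth 0 w i < nth 0 w j -> False) (av w).
Proof.
elim: w => [|a w IH] /=; first by constructor.
apply: (iffP andP) => [[/(pairwiseP 0) P /IH H] [|i] [|j] [|k] //= ij jk kw|H].
- move=> H1 H2; have := P j k _ _ jk; rewrite !inE H1 H2.
  by move/(_ (ltn_trans jk kw) kw).
- exact: H.
split.
  apply/(pairwiseP 0) => j k _; rewrite inE => kw jk; apply/negP => /andP[H1 H2].
  exact: (H 0 j.+1 k.+1).
by apply/IH => i j k ij jk kw; apply: (H i.+1 j.+1 k.+1).
Qed.

Lemma avoids231E s : avoids231 s = av s.
Proof.
apply/avoids231P/avP => H i j k.
  by move=> ij jk ks; apply: (H i.+1 j.+1 k.+1).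
by case: i j k => [|i] [|j] [|k] // _ *; apply: (H i j k).
Qed.

(** The leading 0 is the smallest letter, so it cannot be the 2 of a 231. *)
Lemma good_word n s : good n.+1 [:: 0 :: s] = is_perm n s && avoids231 s.
Proof.
rewrite /good avoids231E [flatten _]/= cats0 perm_cons /= !andbT; congr (_ && _).
by rewrite (_ : pairwise _ s) //; elim: s => //= a s ->; rewrite andbT; apply/allP.
Qed.

Lemma mem_dtopP w y : reflect
  (exists i, [/\ i.+1 < size w, nth 0 w i = y & nth 0 w i.+1 < y]) (y \in dtop w).
Proof.
elim: w => [|a w IH]; first by constructor => -[i []].
rewrite [dtop _]/= mem_cat; apply: (iffP orP) => [[|/IH[i Hi]]|[[|i] [H1 H2 H3]]].
- case: w {IH} => // b w; case: ifP => // H; rewrite inE => /eqP ->.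
  by exists 0.
- by exists i.+1.
- by left; subst y; case: w H1 H3 {IH} => //= b w _ ->; rewrite inE.
- by right; apply/IH; exists i.
Qed.

Lemma mem_dbotP p w y : reflect
  (exists i, [/\ i < size w, nth 0 w i = y & y < nth 0 (p :: w) i]) (y \in dbot_from p w).
Proof.
elim: w p => [|a w IH] p; first by constructor => -[i []].
rewrite [dbot_from _ _]/= mem_cat; apply: (iffP orP) => [[|/IH[i Hi]]|[[|i] [H1 H2 H3]]].
- by case: ifP => // H; rewrite inE => /eqP ->; exists 0.
- by exists i.+1.
- by left; move: H3; rewrite -H2 /= => ->; rewrite inE.
- by right; apply/IH; exists i.
Qed.

Lemma is_desc_topE n s x : is_perm n s -> 0 < x <= n ->
  is_desc_top s x = (x \in dtop s).
Proof.
move=> ps Hx; have p := pos_in ps Hx; have sz := is_perm_size ps.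
rewrite /is_desc_top sz; apply/andP/mem_dtopP => [[H1 H2]|[i [H1 <- H3]]].
  exists (pos s x).-1; rewrite sz.
  by split; [lia|apply: (posK ps)|rewrite prednK //; case/andP: p].
by rewrite -[nth 0 s i]/(val_at s i.+1) (val_atK ps); [split; [lia|]|lia].
Qed.

Lemma is_desc_botE n s x : is_perm n s -> 0 < x <= n ->
  is_desc_bot s x = (x \in dbot_from 0 s).
Proof.
move=> ps Hx; have p := pos_in ps Hx; have sz := is_perm_size ps.
rewrite /is_desc_bot; apply/andP/mem_dbotP => [[H1 H2]|[i [H1 <- H3]]].
  exists (pos s x).-1; rewrite sz.
  split; [lia|exact: (posK ps)|move: H1 H2].
  by case: (pos s x) => [|[|i]].
rewrite -[nth 0 s i]/(val_at s i.+1) (val_atK ps); last lia.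
by case: i H1 H3.
Qed.

(** With equal counts on 1, ..., n, the sentinel makes the final height 1; the word is the single
    block without its leading 0. *)
Lemma run_word (T B : pred nat) n : T 0 = false -> B 0 ->
  (forall x, 0 < x <= n -> count T (iota 1 x) <= count B (iota 1 x.-1)) ->
  count T (iota 1 n) = count B (iota 1 n) ->
  exists s, [/\ is_perm n s, avoids231 s &
    forall y, 0 < y <= n -> is_desc_top s y = T y /\ is_desc_bot s y = B y].
Proof.
move=> T0 B0 H E; have [G N TB L] := run_inv T0 B0 H (leqnn _).
rewrite !count_iota0 T0 B0 E => /addIn.
case: (run T B n.+1) G N TB L => [|b [|]] // G N TB L _.
case: b G N TB L => [|a s] G N TB /=; first by rewrite inE in N.
move/(_ isT) => a0; subst a; move: (G); rewrite good_word => /andP[ps av].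
exists s; split => // y Hy; have [-> ->] := TB y ltac:(lia).
rewrite (is_desc_topE ps) // (is_desc_botE ps) // /tops /bots /= !cats0.
by rewrite inE; case: s {G N TB ps av}; case: y Hy.
Qed.

(** Behind a leading 0, both words are the output of the same run. *)
Lemma desc_inj n s t : is_perm n s -> avoids231 s -> is_perm n t -> avoids231 t ->
  (forall y, 0 < y <= n -> is_desc_top s y = is_desc_top t y /\
     is_desc_bot s y = is_desc_bot t y) -> s = t.
Proof.
move=> ps avs pt avt H.
pose T := is_desc_top s; pose B y := (y == 0) || is_desc_bot s y.
have R u : is_perm n u -> avoids231 u -> (forall y, 0 < y <= n ->
    is_desc_top s y = is_desc_top u y /\ is_desc_bot s y = is_desc_bot u y) ->
    run T B n.+1 = [:: 0 :: u].
  move=> pu avu Hu; apply: run_good; rewrite ?good_word ?pu //.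
    have -> : tops [:: 0 :: u] = dtop u by rewrite /tops /= cats0; case: (u).
    case=> [_|y Hy].
      have -> : T 0 = false.
        (* The absent letter 0 gets the default position [(size s).+1], which fails the bound in
           [is_desc_top]. *)
        have /memNindex i0 : 0 \notin s by rewrite (is_perm_mem _ ps).
        by rewrite /T /is_desc_top /pos i0; apply/negbTE/negP => /andP[]; lia.
      by apply/esym/negP => /mem_dtopP[i []].
    by rewrite /T (Hu _ _).1 ?(is_desc_topE pu).
  case=> [_|y Hy]; rewrite /bots /= cats0 ?inE //=.
  by rewrite /B (Hu _ _).2 ?(is_desc_botE pu).
by have := R s ps avs (fun _ _ => conj erefl erefl); rewrite (R t pt avt H) => -[].
Qed.

(** * The matching of descent tops with descent bottoms *)

Lemma is_desc_top_val n s i : is_perm n s -> 0 < i <= n ->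
  is_desc_top s (val_at s i) = (i <= n.-1) && (val_at s i.+1 < val_at s i).
Proof. by move=> ps Hi; rewrite /is_desc_top (val_atK ps Hi) (is_perm_size ps). Qed.

Lemma is_desc_bot_val n s i : is_perm n s -> 0 < i <= n ->
  is_desc_bot s (val_at s i) = (2 <= i) && (val_at s i < val_at s i.-1).
Proof. by move=> ps Hi; rewrite /is_desc_bot (val_atK ps Hi). Qed.

Lemma count_desc_top n s (Q : pred nat) : is_perm n s ->
  count (fun y => is_desc_top s y && Q y) (iota 1 n) =
  count (fun i => (val_at s i.+1 < val_at s i) && Q (val_at s i)) (iota 1 n.-1).
Proof.
move=> ps; rewrite -(count_val_at (fun _ y => is_desc_top s y && Q y) ps).
rewrite (eq_in_count1 (fun i Hi => congr1 (andb^~ _) (is_desc_top_val ps Hi))).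
case: n ps => // n ps; rewrite count_iotaS add1n ltnn addn0 /=.
by apply: eq_in_count1 => i /andP[_ ->].
Qed.

Lemma count_desc_bot n s (Q : pred nat) : is_perm n s ->
  count (fun y => is_desc_bot s y && Q y) (iota 1 n) =
  count (fun i => (val_at s i.+1 < val_at s i) && Q (val_at s i.+1)) (iota 1 n.-1).
Proof.
move=> ps; rewrite -(count_val_at (fun _ y => is_desc_bot s y && Q y) ps).
rewrite (eq_in_count1 (fun i Hi => congr1 (andb^~ _) (is_desc_bot_val ps Hi))).
case: n ps => // n ps; rewrite [iota _ _]/= /= add0n -[2]/(1 + 1) iotaDl count_map.
by apply: eq_in_count1 => -[|i].
Qed.

(** This is d(x); unlike [cstat], it counts descents on both sides of [x]. *)
Definition crossing (s : seq nat) (x : nat) : nat :=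
  count (fun i => (val_at s i.+1 < x) && (x < val_at s i)) (iota 1 (size s).-1).

(** A descent with bottom below [x] either has its top at most [x] or passes over [x]. *)
Lemma count_bot_top n s x : is_perm n s -> 0 < x <= n ->
  count (is_desc_bot s) (iota 1 x.-1) =
  count (is_desc_top s) (iota 1 x) + crossing s x.
Proof.
move=> ps Hx; rewrite -(@count_iota_le n) -?(@count_iota_le n x); [|lia|lia].
rewrite (count_desc_bot _ ps) (count_desc_top _ ps) /crossing (is_perm_size ps).
by apply: count_addE => i _; lia.
Qed.

Lemma count_bot_topT n s : is_perm n s ->
  count (is_desc_bot s) (iota 1 n) = count (is_desc_top s) (iota 1 n).
Proof.
move=> ps; rewrite (eq_count (fun y => esym (andbT (is_desc_bot s y)))).
rewrite (count_desc_bot predT ps) -(count_desc_top predT ps).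
by apply: eq_count => y; rewrite andbT.
Qed.

(** A later descent passing over [x] would form a 231 with it. *)
Lemma cstat0 n s x : is_perm n s -> avoids231 s -> x \in s -> cstat s x = 0.
Proof.
move=> ps /avoids231P av; rewrite (is_perm_mem _ ps) => Hx; apply/eqP.
rewrite -leqn0 leqNgt -has_count; apply/hasPn => j; rewrite mem_iota => Hj.
have Hp := pos_in ps Hx; have sz := is_perm_size ps.
apply/negP => /andP[H1 H2]; rewrite -(posK ps Hx) in H1 H2.
by apply: (av (pos s x) j j.+1); rewrite ?sz //; lia.
Qed.

Lemma all_take_sorted t : uniq t ->
  all (fun x => count (fun y => x < y) (take (index x t) t) == 0) t = sorted leq t.
Proof.
rewrite (sorted_pairwise leq_trans).
elim: t => //= a t IH /andP[Ha Ut]; rewrite eqxx /= -(IH Ut) -all_predI.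
apply: eq_in_all => x Hx /=; case: (a =P x) => [e|_] /=; first by rewrite e Hx in Ha.
by rewrite addn_eq0 eqb0 -leqNgt.
Qed.

Lemma all_drop_sorted t : uniq t ->
  all (fun x => count (fun y => y < x) (drop (index x t).+1 t) == 0) t = sorted leq t.
Proof.
rewrite (sorted_pairwise leq_trans).
elim: t => //= a t IH /andP[Ha Ut]; rewrite eqxx /= drop0 -(IH Ut); congr (_ && _).
  rewrite -leqn0 leqNgt -has_count -all_predC; apply: eq_all => x /=.
  by rewrite -leqNgt.
by apply: eq_in_all => x Hx /=; case: (a =P x) => [e|_] //=; rewrite e Hx in Ha.
Qed.

Lemma sort_filter_iota n s (P : pred nat) : is_perm n s ->
  sort leq [seq x <- s | P x] = [seq x <- iota 1 n | P x].
Proof.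
move=> ps; apply: (sorted_eq leq_trans anti_leq); first exact: sort_sorted leq_total _.
  by apply: (sorted_filter leq_trans); apply: iota_sorted.
by rewrite perm_sort; apply: perm_filter.
Qed.

(** Only the sorted arrangement passes the test, so the head does not depend on the order of
    enumeration. *)
Lemma head_permutations_sorted n s (P : pred nat) (Q : pred (seq nat)) : is_perm n s ->
  (forall t, uniq t -> {subset t <= s} -> Q t = sorted leq t) ->
  head [::] [seq t <- permutations [seq x <- s | P x] | Q t] = [seq x <- iota 1 n | P x].
Proof.
move=> ps H; set u := [seq x <- s | P x].
have HQ t : perm_eq t u -> Q t = sorted leq t.
  move=> tu; apply: H; first by rewrite (perm_uniq tu) filter_uniq // (is_perm_uniq ps).
  by move=> x; rewrite (perm_mem tu) mem_filter => /andP[].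
rewrite -(sort_filter_iota _ ps) -/u.
have: sort leq u \in [seq t <- permutations u | Q t].
  rewrite mem_filter mem_permutations perm_sort perm_refl HQ ?perm_sort //.
  by rewrite (sort_sorted leq_total).
case E: [seq _ <- _ | _] => [//|t l] _ /=.
have: t \in t :: l by rewrite inE eqxx.
rewrite -E mem_filter mem_permutations => /andP[Qt tu]; rewrite HQ // in Qt.
apply: (sorted_eq leq_trans anti_leq) => //; first exact: sort_sorted leq_total _.
by rewrite perm_sym perm_sort perm_sym.
Qed.

Lemma phi_f'E n s : is_perm n s -> avoids231 s ->
  phi_f' s = [seq x <- iota 1 n | is_desc_top s x].
Proof.
move=> ps av; apply: (head_permutations_sorted _ ps) => t Ut st.
by rewrite -all_take_sorted //; apply: eq_in_all => x /st Hx; rewrite (cstat0 ps).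
Qed.

Lemma phi_g'E n s : is_perm n s -> avoids231 s ->
  phi_g' s = [seq x <- iota 1 n | ~~ is_desc_top s x].
Proof.
move=> ps av; apply: (head_permutations_sorted _ ps) => t Ut st.
by rewrite -all_drop_sorted //; apply: eq_in_all => x /st Hx; rewrite (cstat0 ps).
Qed.

(* t maps the k-th smallest element of T to the k-th smallest element of B, and
   likewise for the complements. *)
Definition matches n (T B : pred nat) (t : seq nat) :=
  [/\ is_perm n t,
      map (val_at t) [seq x <- iota 1 n | T x] = [seq x <- iota 1 n | B x]
    & map (val_at t) [seq x <- iota 1 n | ~~ T x] = [seq x <- iota 1 n | ~~ B x]].

Lemma Phi_matches n s : is_perm n s -> avoids231 s ->
  matches n (is_desc_top s) (is_desc_bot s) (Phi s).
Proof.
move=> ps av; have sz := is_perm_size ps.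
have U (P : pred nat) :
    perm_eq ([seq x <- iota 1 n | P x] ++ [seq x <- iota 1 n | ~~ P x]) (iota 1 n).
  by apply: permEl; apply: perm_filterC.
have E : size [seq x <- iota 1 n | is_desc_bot s x] = size [seq x <- iota 1 n | is_desc_top s x].
  by rewrite !size_filter (count_bot_topT ps).
rewrite /Phi /phi_f /phi_g (phi_f'E ps) // (phi_g'E ps) // !(sort_filter_iota _ ps) sz.
set top := _ ++ _; set bot := _ ++ _; set t := map _ _.
have Ut : perm_eq top (iota 1 n) by apply: U.
have Ub : perm_eq bot (iota 1 n) by apply: U.
have tE b : 0 < b <= n -> val_at t b = nth 0 top (index b bot).
  move=> Hb; rewrite /val_at (nth_map 0) ?size_iota; last lia.
  rewrite nth_iota; last lia.
  by congr (nth _ _ (index _ _)); lia.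
have M : map (val_at t) bot = top.
  apply: (@eq_from_nth _ 0); rewrite size_map ?(perm_size Ub) ?(perm_size Ut) // => i.
  rewrite size_iota => Hi; have Hib : i < size bot by rewrite (perm_size Ub) size_iota.
  rewrite (nth_map 0) // tE ?index_uniq ?(perm_uniq Ub) ?iota_uniq //.
  by rewrite -mem_iota1 -(perm_mem Ub) mem_nth.
(* Tops and bottoms being equally many, both rows are cut at the same column. *)
have /eqP := M; rewrite map_cat eqseq_cat ?size_map ?E // => /andP[/eqP M1 /eqP M2].
split => //; have st : size t = n by rewrite size_map size_iota.
by rewrite /is_perm -(map_val_at t) st -(permPr Ut) -M perm_map // perm_sym.
Qed.

(** * Permutations matching two sets increasingly *)

Lemma matches_inj n T B t u : matches n T B t -> matches n T B u -> t = u.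
Proof.
move=> [pt t1 t2] [pu u1 u2]; have st := is_perm_size pt; have su := is_perm_size pu.
rewrite -(map_val_at t) -(map_val_at u) st su; apply/eq_in_map => x Hx.
case: (boolP (T x)) => Tx.
  by have /eq_in_map := etrans t1 (esym u1); apply; rewrite mem_filter Tx.
by have /eq_in_map := etrans t2 (esym u2); apply; rewrite mem_filter Tx.
Qed.

Lemma sorted_map_homo (f : nat -> nat) l : sorted ltn l -> sorted ltn (map f l) ->
  {in l &, {homo f : x y / x < y}}.
Proof.
move=> sl sfl x y Hx Hy xy.
have ixy : index x l < index y l.
  rewrite ltnNge; apply/negP => H.
  have sl' : sorted leq l by apply: sub_sorted sl => a b; apply: ltnW.
  by have := sorted_leq_index leq_trans leqnn sl' y x Hy Hx H; rewrite leqNgt xy.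
have := sorted_ltn_nth ltn_trans 0 sfl (index x l) (index y l).
rewrite !inE size_map !index_mem Hx Hy !(nth_map 0) ?index_mem // !nth_index //.
by apply.
Qed.

Lemma matchesC n T B t : matches n T B t -> matches n (predC T) (predC B) t.
Proof.
case=> pt t1 t2; split => //=.
by rewrite (eq_filter (fun x => negbK (T x))) (eq_filter (fun x => negbK (B x))).
Qed.

Lemma matches_mem n T B t x : matches n T B t -> 0 < x <= n -> B (val_at t x) = T x.
Proof.
move=> [pt t1 t2] Hx; case: (boolP (T x)) => Tx.
  have: val_at t x \in map (val_at t) [seq x <- iota 1 n | T x].
    by apply: map_f; rewrite mem_filter Tx mem_iota1.
  by rewrite t1 mem_filter => /andP[].
have: val_at t x \in map (val_at t) [seq x <- iota 1 n | ~~ T x].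
  by apply: map_f; rewrite mem_filter Tx mem_iota1.
by rewrite t2 mem_filter => /andP[/negbTE].
Qed.

Lemma matches_mono n T B t x y : matches n T B t -> 0 < x <= n -> 0 < y <= n ->
  T x = T y -> (val_at t x <= val_at t y) = (x <= y).
Proof.
wlog Tx : T B / T x => [W M Hx Hy e|].
  have [|/negbTE Tx] := boolP (T x); first by move=> Tx; apply: (W T B).
  by apply: (W (predC T) (predC B)) => //=; [rewrite Tx|apply: matchesC|rewrite e].
case=> pt t1 _ Hx Hy; rewrite Tx => /esym Ty.
have S P : sorted ltn [seq x <- iota 1 n | P x].
  by apply: (sorted_filter ltn_trans); apply: iota_ltn_sorted.
have := S B; rewrite -t1 => /(sorted_map_homo (S T))/leq_mono_in; apply.
  by rewrite mem_filter Tx mem_iota1.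
by rewrite mem_filter Ty mem_iota1.
Qed.

(** Being increasing on [T], [t] sends the elements of [T] up to [x] onto those of [B] up to
    [val_at t x]. *)
Lemma matches_rank n T B t x : matches n T B t -> 0 < x <= n -> T x ->
  count T (iota 1 x) = count B (iota 1 (val_at t x)).
Proof.
move=> M Hx Tx; have [pt _ _] := M; have Hv := val_at_in pt Hx.
rewrite -(@count_iota_le n) -?(@count_iota_le n (val_at t x)); [|lia|lia].
rewrite -(count_val_at (fun _ y => B y && (y <= val_at t x)) pt).
apply: eq_in_count1 => y Hy; rewrite (matches_mem M Hy).
by case: (boolP (T y)) => //= Ty; rewrite (matches_mono M) // Ty.
Qed.

(** As d takes natural values, this also carries the inequality between the two counts. *)
Definition excess n (T B : pred nat) (d : nat -> nat) :=
  forall x, 0 < x <= n -> count B (iota 1 x.-1) = count T (iota 1 x) + d x.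

Lemma matches_rankC n T B t x : matches n T B t -> 0 < x <= n -> ~~ T x ->
  x - count T (iota 1 x) = val_at t x - count B (iota 1 (val_at t x)).
Proof.
move=> M Hx Tx; rewrite -!count_iota_predC; exact: (matches_rank (matchesC M)).
Qed.

(** Ranks are compared. For [x] in [T], an image at or above [x] would have rank in [B] exceeding
    the number of elements of [B] below [x], hence the rank of [x] in [T]. Off [T], the ranks in the
    complements exclude an image below [x]. *)
Lemma matches_drop n T B t d x : matches n T B t -> excess n T B d -> 0 < x <= n ->
  (val_at t x < x) = T x.
Proof.
move=> M D Hx; have [pt _ _] := M; have Hv := val_at_in pt Hx.
have Bx := matches_mem M Hx; have Dx := D x Hx.
have CT := count_size T (iota 1 x); rewrite size_iota in CT.
have CB := count_size B (iota 1 (val_at t x)); rewrite size_iota in CB.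
case: (boolP (T x)) => Tx; rewrite ltnNge.
  have R := matches_rank M Hx Tx; apply/negP => H.
  have V0 : 0 < val_at t x by case/andP: Hv.
  have := count_pred B V0; rewrite Bx Tx.
  have := @count_iota_lip B x.-1 (val_at t x).-1; lia.
have R := matches_rankC M Hx Tx; apply/negbF; rewrite leqNgt; apply/negP => H.
have := @count_iota_lip B (val_at t x) x.-1; lia.
Qed.

(** Off [T], [x] has the same rank outside [T] as its image has outside [B]. If [x] is also outside
    [B], the two ranks of [x] itself differ by d(x), so [x] is its own image exactly when d(x) =
    0. *)
Lemma matches_fix n T B t d x : matches n T B t -> excess n T B d -> 0 < x <= n ->
  (val_at t x == x) = [&& ~~ T x, ~~ B x & d x == 0].
Proof.
move=> M D Hx; have [pt _ _] := M; have Hv := val_at_in pt Hx.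
have Bx := matches_mem M Hx; have Dx := D x Hx; have dr := matches_drop M D Hx.
case: (boolP (T x)) => Tx /=; first by rewrite Tx in dr; apply/negbTE; lia.
have R := matches_rankC M Hx Tx.
have CT := count_size T (iota 1 x); rewrite size_iota in CT.
have CB := count_size B (iota 1 (val_at t x)); rewrite size_iota in CB.
have CB' := count_size B (iota 1 x); rewrite size_iota in CB'.
have P : count B (iota 1 x) = count B (iota 1 x.-1) + B x.
  by apply: count_pred; case/andP: Hx.
have P' : count B (iota 1 (val_at t x)) = count B (iota 1 (val_at t x).-1).
  by rewrite count_pred ?Bx ?(negbTE Tx) ?addn0 //; case/andP: Hv.
rewrite (negbTE Tx) in Bx dr.
apply/eqP/andP => [e|[nB /eqP d0]].
  by rewrite e in R Bx; rewrite Bx in P *; split => //; lia.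
have := @count_iota_lip B x (val_at t x).-1; rewrite (negbTE nB) in P; lia.
Qed.

Lemma matches_pos_gt n T B t d x : matches n T B t -> excess n T B d -> 0 < x <= n ->
  (x < pos t x) = B x.
Proof.
move=> M D Hx; have [pt _ _] := M; have Hp := pos_in pt Hx.
by rewrite -{1}(posK pt Hx) (matches_drop M D Hp) -(matches_mem M Hp) (posK pt Hx).
Qed.

(** The elements of [T] up to [i] are the positions of the letters of [B] placed at or before [i];
    what remains of [B] below [i] is placed beyond [i]. *)
Lemma matches_cross n T B t d i : matches n T B t -> excess n T B d -> 0 < i <= n ->
  d i = count (fun j => (j < i) && (i < pos t j)) (iota 1 n).
Proof.
move=> M D Hi; have [pt _ _] := M; apply: (@addnI (count T (iota 1 i))).
rewrite -(D i Hi) -(@count_iota_le n) -?(@count_iota_le n i); [|lia|lia].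
have -> : count (fun y => T y && (y <= i)) (iota 1 n) =
          count (fun x => B x && (pos t x <= i)) (iota 1 n).
  rewrite -(count_val_at (fun y x => B x && (y <= i)) pt).
  by apply: eq_in_count1 => y Hy; rewrite (matches_mem M Hy).
apply: count_addE => j; rewrite mem_iota1 => Hj.
have := matches_pos_gt M D Hj; case: (B j); lia.
Qed.

(** There are as many letters as positions up to [i], so as many letters leave this segment as enter
    it. Here the letter [i] itself does not leave, being outside [B]. *)
Lemma matches_cross_low n T B t d i : matches n T B t -> excess n T B d -> 0 < i <= n ->
  ~~ B i -> d i = count (fun j => (pos t j <= i) && (i < j)) (iota 1 n).
Proof.
move=> M D Hi Bi; have [pt _ _] := M; rewrite (matches_cross M D Hi).
pose K := count (fun j => (j <= i) && (pos t j <= i)) (iota 1 n).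
apply: (@addnI K).
have <- : count (fun j => j <= i) (iota 1 n) =
   K + count (fun j => (j < i) && (i < pos t j)) (iota 1 n).
  apply: count_addE => j; rewrite mem_iota1 => Hj.
  case: (j =P i) => [e|]; last lia.
  by have := matches_pos_gt M D Hi; rewrite (negbTE Bi) e; lia.
rewrite (count_val_at (fun y _ => y <= i) pt).
by apply: count_addE => j _; lia.
Qed.

Lemma matches_pos_mono n T B t i j : matches n T B t -> 0 < i <= n -> 0 < j <= n ->
  B i = B j -> (pos t i <= pos t j) = (i <= j).
Proof.
move=> M Hi Hj e; have [pt _ _] := M; have [Pi Pj] := (pos_in pt Hi, pos_in pt Hj).
rewrite -[in RHS](posK pt Hi) -[in RHS](posK pt Hj) (matches_mono M) //.
by rewrite -(matches_mem M Pi) -(matches_mem M Pj) !(posK pt).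
Qed.

(** For [i] in [B] only the first kind of crossing can occur, otherwise only the second. The other
    letter is then in the same class as [i], where monotonicity supplies the remaining
    comparison. *)
Lemma matches_icr n T B t d : matches n T B t -> excess n T B d ->
  st_icr t = sumn [seq d i | i <- iota 1 n].
Proof.
move=> M D; have [pt _ _] := M; rewrite /st_icr /st_cros size_invp (is_perm_size pt).
congr sumn; apply/eq_in_map => i; rewrite mem_iota1 => Hi.
have Gi := matches_pos_gt M D Hi.
have [Bi|Bi] := boolP (B i).
  rewrite (matches_cross M D Hi); apply: eq_in_count1 => j Hj.
  rewrite !(val_at_invp pt) //; have Gj := matches_pos_gt M D Hj.
  have mj := matches_pos_mono M Hi Hj; move: Gi Gj mj; rewrite Bi.
  case: (B j) => Gi Gj mj; last lia.
  by have := mj erefl; lia.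
rewrite (matches_cross_low M D Hi Bi); apply: eq_in_count1 => j Hj.
rewrite !(val_at_invp pt) //; have Gj := matches_pos_gt M D Hj.
have mj := matches_pos_mono M Hj Hi; move: Gi Gj mj; rewrite (negbTE Bi).
case: (B j) => Gi Gj mj; first lia.
by have := mj erefl; lia.
Qed.

(** Of three positions, two lie in the same class, on which [t] is increasing. *)
Lemma matches_avoids321 n T B t : matches n T B t -> avoids321 t.
Proof.
move=> M; have [pt _ _] := M; apply/avoids321P => i j k.
rewrite (is_perm_size pt) => i0 ij jk kn H1 H2.
have Hi : 0 < i <= n by lia.
have Hj : 0 < j <= n by lia.
have Hk : 0 < k <= n by lia.
have mono a b : 0 < a <= n -> 0 < b <= n -> a < b -> T a = T b -> val_at t a < val_at t b.
  by move=> Ha Hb ab e; rewrite ltnNge (matches_mono M) // -ltnNge.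
have := mono i j Hi Hj ij; have := mono j k Hj Hk jk.
have := mono i k Hi Hk (ltn_trans ij jk).
rewrite !ltnNge (ltnW H1) (ltnW H2) (ltnW (ltn_trans H1 H2)).
by case: (T i); case: (T j); case: (T k) => A1 A2 A3;
  do ?[by have := A1 erefl|by have := A2 erefl|by have := A3 erefl].
Qed.

(** It suffices that [t] is increasing on each class: a decrease inside a class forces, by
    pigeonhole, a third letter that completes a 321. *)
Lemma drop_matches n t : is_perm n t -> avoids321 t ->
  matches n (fun x => val_at t x < x) (fun x => x < pos t x) t.
Proof.
move=> pt /avoids321P; rewrite (is_perm_size pt) => av.
have cnt y : y <= n -> count (fun k => val_at t k <= y) (iota 1 n) = y.
  move=> Hy; rewrite (count_val_at (fun _ x => x <= y) pt).
  by rewrite (count_iota_le predT Hy) count_predT size_iota.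
have S P : sorted ltn [seq x <- iota 1 n | P x].
  by apply: (sorted_filter ltn_trans); apply: iota_ltn_sorted.
have main (P Q : pred nat) : (forall x, 0 < x <= n -> P x = Q (val_at t x)) ->
    (forall i j, 0 < i -> i < j -> j <= n -> P i -> P j -> val_at t i < val_at t j) ->
    map (val_at t) [seq x <- iota 1 n | P x] = [seq x <- iota 1 n | Q x].
  move=> PQ mono; apply: (irr_sorted_eq ltn_trans ltnn) => //.
    apply: (@homo_sorted_in _ _ [in [seq x <- iota 1 n | P x]] _ ltn) => //.
      move=> x y; rewrite !mem_filter !mem_iota1 => /andP[Px Hx] /andP[Py Hy] xy.
      by apply: mono => //; [case/andP: Hx|case/andP: Hy].
  move=> y; apply/mapP/idP => [[x]|].
    rewrite !mem_filter !mem_iota1 => /andP[Px Hx] ->.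
    by rewrite -PQ // Px val_at_in.
  rewrite mem_filter mem_iota1 => /andP[Qy Hy]; exists (pos t y); last by rewrite (posK pt).
  have Hp := pos_in pt Hy.
  by rewrite mem_filter mem_iota1 PQ // (posK pt) // Qy.
split=> //; apply: main => [x Hx|i j i0 ij jn Pi Pj].
- by rewrite (val_atK pt).
- have Hi : 0 < i <= n by rewrite i0 ltnW // (leq_trans ij).
  have Hj : 0 < j <= n by rewrite (ltn_trans i0 ij).
  rewrite ltnNge; apply/negP => H.
  (* Pigeonhole: otherwise the first i positions carry letters at most t(i) < i. *)
  have nh k : 0 < k <= i -> val_at t k <= val_at t i.
    move=> Hk; rewrite leqNgt; apply/negP => Hki.
    have ki : k < i by case: (ltngtP k i) Hki Hk => [//||->]; rewrite ?ltnn; lia.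
    have ne : val_at t j <> val_at t i by move/(val_at_inj pt Hj Hi); lia.
    by apply: (av k i j) => //; [case/andP: Hk|lia].
  have Hv := val_at_in pt Hi; have := cnt (val_at t i) ltac:(lia).
  rewrite -(subnKC (ltac:(lia) : i <= n)) iotaD count_cat.
  rewrite (eq_in_count1 (Q := predT)) => [|k Hk]; last by rewrite nh.
  rewrite count_predT size_iota; lia.
- by rewrite (val_atK pt).
- have Hi : 0 < i <= n by rewrite i0 ltnW // (leq_trans ij).
  have Hj : 0 < j <= n by rewrite (ltn_trans i0 ij).
  rewrite ltnNge; apply/negP => H.
  have ne : val_at t j <> val_at t i by move/(val_at_inj pt Hj Hi); lia.
  (* Pigeonhole: otherwise the t(j) - 1 >= j - 1 letters below t(j) all sit on the
     first j - 1 positions, one of which is i. *)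
  have nh k : j <= k <= n -> val_at t j <= val_at t k.
    move=> /andP[jk kn]; rewrite leqNgt; apply/negP => Hki.
    have jk' : j < k by case: (ltngtP j k) Hki jk => [//||->]; rewrite ?ltnn.
    by apply: (av i j k) => //; lia.
  have Hv := val_at_in pt Hj; have := cnt (val_at t j).-1 ltac:(lia).
  have -> : count (fun k => val_at t k <= (val_at t j).-1) (iota 1 n) =
            count (fun k => (val_at t k <= (val_at t j).-1) && (k <= j.-1)) (iota 1 n).
    apply: eq_in_count1 => k Hk; case: (leqP j k) => jk.
      by have := nh k; rewrite jk (proj2 (andP Hk)) => /(_ isT); lia.
    by rewrite (_ : k <= j.-1) ?andbT //; lia.
  rewrite count_iota_le; last lia.
  have := count_predC (fun k => val_at t k <= (val_at t j).-1) (iota 1 j.-1).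
  rewrite size_iota.
  have : 0 < count (predC (fun k => val_at t k <= (val_at t j).-1)) (iota 1 j.-1).
    by rewrite -has_count; apply/hasP; exists i; rewrite ?mem_iota1 /=; lia.
  move: Pj => /=; lia.
Qed.

(** * Statistics and bijectivity *)

Lemma Phi_excess n s : is_perm n s ->
  excess n (is_desc_top s) (is_desc_bot s) (crossing s).
Proof. by move=> ps x; apply: count_bot_top. Qed.

Lemma sumn_count_exchange (S T : Type) (R : S -> T -> bool) l1 l2 :
  sumn [seq count (R i) l2 | i <- l1] = sumn [seq count (R^~ x) l1 | x <- l2].
Proof.
elim: l1 => [|a l1 IH] /=; first by elim: l2.
by rewrite IH; elim: l2 {IH} => //= b l2 <-; rewrite addnACA.
Qed.

(** A letter between the two ends of a descent stands to its right, since on its left it would be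
    the 2 of a 231. The pairs are then summed by letter instead of by descent. *)
Lemma st_31_2E n s : is_perm n s -> avoids231 s ->
  st_31_2 s = sumn [seq crossing s x | x <- iota 1 n].
Proof.
move=> ps /avoids231P; rewrite (is_perm_size ps) => av.
(* The bound on [i] excludes a false descent to the default value 0 past the end. *)
pose R i x := [&& i < n, val_at s i.+1 < x & x < val_at s i].
transitivity (sumn [seq count (R i) (iota 1 n) | i <- iota 1 n]).
  rewrite /st_31_2 (is_perm_size ps); congr sumn; apply/eq_in_map => i.
  rewrite mem_iota1 => Hi; rewrite -(count_val_at (fun _ x => R i x) ps) /R.
  case: (ltnP i n) => ni /=; last by rewrite (_ : n - i.+1 = 0) ?count_pred0 //; lia.
  rewrite -[in RHS](subnKC ni) iotaD count_cat add1n.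
  rewrite [X in _ = X + _](_ : _ = 0) //; apply/eqP; rewrite -leqn0 leqNgt -has_count.
  apply/hasPn => j; rewrite mem_iota1 => Hj; apply/negP => /andP[H1 H2].
  case: (ltngtP j i) => ji; last by rewrite ji ltnn in H2.
    by apply: (av j i i.+1) => //; case/andP: Hj.
  by rewrite (_ : j = i.+1) ?ltnn // in H1; lia.
rewrite sumn_count_exchange; congr sumn; apply/eq_in_map => x _.
rewrite /crossing (is_perm_size ps); case: n {ps av} @R => // n R.
rewrite count_iotaS /R add1n ltnn addn0; apply: eq_in_count1 => i Hi.
by rewrite ltnS (proj2 (andP Hi)).
Qed.

Lemma ext_at_val n s i : is_perm n s -> 0 < i <= n -> ext_at s i = val_at s i.
Proof.
by move=> ps Hi; rewrite /ext_at (is_perm_size ps); case: i Hi => //= i Hi; rewrite ltnNge Hi.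
Qed.

Lemma ext_at_desc n s i : is_perm n s -> 0 < i <= n ->
  [/\ (ext_at s i < ext_at s i.-1) = is_desc_bot s (val_at s i),
      (ext_at s i.-1 < ext_at s i) = ~~ is_desc_bot s (val_at s i),
      (ext_at s i.+1 < ext_at s i) = is_desc_top s (val_at s i)
    & (ext_at s i < ext_at s i.+1) = ~~ is_desc_top s (val_at s i)].
Proof.
move=> ps Hi; have Vi := val_at_in ps Hi.
rewrite (is_desc_bot_val ps Hi) (is_desc_top_val ps Hi) !(ext_at_val ps Hi).
have A : (ext_at s i.-1 == val_at s i) = false /\
    (val_at s i < ext_at s i.-1) = (1 < i) && (val_at s i < val_at s i.-1).
  case: i Hi Vi => [|[|i]] // Hi Vi; first by rewrite /ext_at /=; lia.
  rewrite /= (ext_at_val (i := i.+1) ps); last lia.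
  split=> //; apply/eqP => /(val_at_inj ps _ Hi) H.
  by have := H ltac:(lia); lia.
have B : (ext_at s i.+1 == val_at s i) = false /\
    (ext_at s i.+1 < val_at s i) = (i <= n.-1) && (val_at s i.+1 < val_at s i).
  case: (leqP i n.-1) => Hn /=; last first.
    have ni : n < i.+1 by lia.
    by rewrite /ext_at (is_perm_size ps) /= ni; lia.
  rewrite (ext_at_val (i := i.+1) ps); last lia.
  split=> //; apply/eqP => /(val_at_inj ps _ Hi) H.
  by have := H ltac:(lia); lia.
move: A B => [A1 A2] [B1 B2]; rewrite -A2 -B2.
by split=> //; rewrite ltn_neqAle ?A1 -?leqNgt // eq_sym B1.
Qed.

Lemma count_ext n s (P : nat -> bool) (Q : pred nat) : is_perm n s ->
  (forall i, 0 < i <= n -> P i = Q (val_at s i)) ->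
  count P (iota 1 (size s)) = count Q (iota 1 n).
Proof.
move=> ps H; rewrite (is_perm_size ps) -(count_val_at (fun _ => Q) ps).
exact: eq_in_count1.
Qed.

(** Going left from [i], the first letter above [val_at s i] would begin a descent passing over it;
    such a descent to the right of [i] would complete a 231. *)
Lemma lr_max_crossing n s i : is_perm n s -> avoids231 s -> 0 < i <= n ->
  ~~ is_desc_bot s (val_at s i) ->
  all (fun j => val_at s j < val_at s i) (iota 1 i.-1) = (crossing s (val_at s i) == 0).
Proof.
move=> ps /avoids231P; rewrite (is_perm_size ps) => av Hi.
rewrite (is_desc_bot_val ps Hi) /crossing (is_perm_size ps) => nB.
rewrite -leqn0 leqNgt -has_count; apply/allP/hasPn => [H k|H j].
  rewrite mem_iota1 => Hk; apply/negP => /andP[H1 H2].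
  case: (ltngtP k i) => ki; last by rewrite ki ltnn in H2.
    by have := H k; rewrite mem_iota1; lia.
  by apply: (av i k k.+1) => //; lia.
rewrite mem_iota1 => /andP[j0 ji].
(* Induction on the distance from [j] to [i.-1]; the base case is that [val_at s i] is not a descent
   bottom. *)
have [m e] : exists m, i.-1 = j + m by exists (i.-1 - j); lia.
elim: m j e {ji} j0 => [|m IH] j e j0.
  have ji : i.-1 = j by lia.
  have ne : val_at s j <> val_at s i by move/(val_at_inj ps); lia.
  by rewrite ji in nB; lia.
have := IH j.+1 ltac:(lia) isT; have := H j; rewrite mem_iota1.
have ne : val_at s j <> val_at s i by move/(val_at_inj ps); lia.
lia.
Qed.

Lemma inv_stats n p : is_perm n p ->
  (st_icr p, st_drop p, st_exc p + st_fix p, st_cda p, st_cdd p, st_cval p, st_cpk p, st_fix p)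
  = (st_cros (invp p), st_exc (invp p), st_drop (invp p) + st_fix (invp p),
     st_cdd (invp p), st_cda (invp p), st_cval (invp p), st_cpk (invp p), st_fix (invp p)).
Proof.
move=> pp; rewrite /st_icr /st_drop /st_exc /st_fix /st_cda /st_cdd /st_cval /st_cpk.
rewrite !size_invp (is_perm_size pp).
have E1 : count (fun i => val_at p i < i) (iota 1 n) =
          count (fun i => i < val_at (invp p) i) (iota 1 n).
  rewrite (count_val_at (fun i v => v < i) pp).
  by apply: eq_in_count1 => x Hx; rewrite (val_at_invp pp).
have E2 : count (fun i => i < val_at p i) (iota 1 n) =
          count (fun i => val_at (invp p) i < i) (iota 1 n).
  rewrite (count_val_at (fun i v => i < v) pp).
  by apply: eq_in_count1 => x Hx; rewrite (val_at_invp pp).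
have E3 : count (fun i => val_at p i == i) (iota 1 n) =
          count (fun i => val_at (invp p) i == i) (iota 1 n).
  rewrite (count_val_at (fun i v => v == i) pp).
  by apply: eq_in_count1 => x Hx; rewrite (val_at_invp pp) // eq_sym.
rewrite -E1 -E2 -E3.
by congr (_, _, _, _, _, _, _, _); apply: eq_in_count1 => x Hx;
  rewrite (val_at_invp pp) // (pos_invp pp) // andbC.
Qed.

Lemma Phi_stats n s : is_perm n s -> avoids231 s ->
  (st_31_2 s, st_des s, st_ascinf s, st_lda s - st_fmax s, st_ldd s,
      st_lval s, st_lpk s, st_fmax s)
  = (st_icr (Phi s), st_drop (Phi s), st_exc (Phi s) + st_fix (Phi s),
        st_cda (Phi s), st_cdd (Phi s), st_cval (Phi s), st_cpk (Phi s),
        st_fix (Phi s)).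
Proof.
move=> ps av; have M := Phi_matches ps av; have D := Phi_excess ps.
have [pt _ _] := M; have st := is_perm_size pt.
set t := Phi s in M pt st *; set T := is_desc_top s in M D; set B := is_desc_bot s in M D.
have dr x (Hx : 0 < x <= n) := matches_drop M D Hx.
have gt x (Hx : 0 < x <= n) := matches_pos_gt M D Hx.
have fx x (Hx : 0 < x <= n) := matches_fix M D Hx.
have pfx x : 0 < x <= n -> (pos t x == x) = (val_at t x == x).
  move=> Hx; apply/eqP/eqP => e; last by rewrite -[in LHS]e (val_atK pt).
  by rewrite -[in LHS]e (posK pt).
have fmaxE : st_fmax s = st_fix t.
  rewrite /st_fix st; apply: (count_ext ps) => i Hi.
  have Vi := val_at_in ps Hi; have [_ -> _ ->] := ext_at_desc ps Hi.
  rewrite fx // -/T -/B; case: (boolP (B _)) => [_|nB] /=.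
    by rewrite andbF.
  by rewrite -(lr_max_crossing ps av Hi nB).
(* A letter outside [T] and [B] satisfies [pos t x <= x <= val_at t x], hence is a cyclic double
   ascent or a fixed point. *)
have ldaE : st_lda s = st_cda t + st_fix t.
  have -> : st_lda s = count (fun x => ~~ B x && ~~ T x) (iota 1 n).
    by apply: (count_ext ps) => i Hi; have [_ -> _ ->] := ext_at_desc ps Hi.
  rewrite /st_cda /st_fix st; apply: count_addE => x; rewrite mem_iota1 => Hx.
  by move: (dr x Hx) (gt x Hx) (fx x Hx) (pfx x Hx); case: (T x); case: (B x) => /=; lia.
congr (_, _, _, _, _, _, _, _) => //.
- by rewrite (matches_icr M D) (st_31_2E ps).
- rewrite /st_drop st (eq_in_count1 dr) (eq_count (fun y => esym (andbT (T y)))).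
  rewrite (count_desc_top predT ps) /st_des (is_perm_size ps).
  by apply: eq_count => i; rewrite andbT.
- have -> : st_ascinf s = count (predC T) (iota 1 n).
    by apply: (count_ext ps) => i Hi; have [_ _ _ ->] := ext_at_desc ps Hi.
  rewrite /st_exc /st_fix st; apply: count_addE => x; rewrite mem_iota1 => Hx /=.
  by rewrite -dr //; lia.
- by rewrite fmaxE ldaE addnK.
- rewrite /st_cdd st; apply: (count_ext ps) => i Hi; have [-> _ -> _] := ext_at_desc ps Hi.
  by rewrite gt ?dr ?val_at_in.
- rewrite /st_cval st; apply: (count_ext ps) => i Hi; have [-> _ _ ->] := ext_at_desc ps Hi.
  have Hx := val_at_in ps Hi; rewrite -/T -/B -gt // -dr //.
  move: (dr _ Hx) (gt _ Hx) (fx _ Hx) (pfx _ Hx).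
  by move: (val_at s i) => x; case: (T x); case: (B x) => /=; lia.
- rewrite /st_cpk st; apply: (count_ext ps) => i Hi; have [_ -> -> _] := ext_at_desc ps Hi.
  have Hx := val_at_in ps Hi; rewrite -/T -/B -gt // -dr //.
  move: (dr _ Hx) (gt _ Hx) (fx _ Hx) (pfx _ Hx).
  by move: (val_at s i) => x; case: (T x); case: (B x) => /=; lia.
Qed.

(** The image determines both sets: tops are its drop positions, bottoms the letters placed beyond
    their own value. *)
Lemma Phi_inj n s t : is_perm n s -> avoids231 s -> is_perm n t -> avoids231 t ->
  Phi s = Phi t -> s = t.
Proof.
move=> ps avs pt avt e; apply: (desc_inj ps avs pt avt) => y Hy.
have Ms := Phi_matches ps avs; have Mt := Phi_matches pt avt.
have Ds := Phi_excess ps; have Dt := Phi_excess pt.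
split.
  by rewrite -(matches_drop Ms Ds Hy) -(matches_drop Mt Dt Hy) e.
by rewrite -(matches_pos_gt Ms Ds Hy) -(matches_pos_gt Mt Dt Hy) e.
Qed.

Lemma Phi_surj n t : is_perm n t -> avoids321 t ->
  exists s, [/\ is_perm n s, avoids231 s & Phi s = t].
Proof.
move=> pt av; have Mt := drop_matches pt av.
pose T y := val_at t y < y; pose B y := y < pos t y.
have [//|//|||s [ps avs H]] := @run_word T B n.
(* A drop position at most [x] carries a letter of [B] at most [x.-1]; counting [B] by positions
   turns the inequality into an inclusion. *)
- move=> x Hx; rewrite -(@count_iota_le n) -?(@count_iota_le n x.-1); [|lia|lia].
  rewrite -(count_val_at (fun y v => (v < y) && (v <= x.-1)) pt).
  by apply: sub_count => y /andP[]; rewrite /T; lia.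
- exact: (count_val_at (fun y v => v < y) pt).
exists s; split => //; apply: (matches_inj (Phi_matches ps avs)).
have eT : {in iota 1 n, is_desc_top s =1 T} by move=> y; rewrite mem_iota1 => /H[].
have eB : {in iota 1 n, is_desc_bot s =1 B} by move=> y; rewrite mem_iota1 => /H[].
case: Mt => _ t1 t2; split => //.
  by rewrite (eq_in_filter eT) (eq_in_filter eB).
have eT' : {in iota 1 n, (fun y => ~~ is_desc_top s y) =1 (fun y => ~~ T y)}.
  by move=> y Hy; rewrite eT.
have eB' : {in iota 1 n, (fun y => ~~ is_desc_bot s y) =1 (fun y => ~~ B y)}.
  by move=> y Hy; rewrite eB.
by rewrite (eq_in_filter eT') (eq_in_filter eB').
Qed.

Theorem theorem2p11 (n : nat) (hn : 1 <= n) :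
  (* Phi maps S_n(231) into S_n(321) *)
  (forall s, is_perm n s -> avoids231 s -> is_perm n (Phi s) && avoids321 (Phi s)) /\
  (* injective on S_n(231) *)
  (forall s t, is_perm n s -> avoids231 s -> is_perm n t -> avoids231 t ->
     Phi s = Phi t -> s = t) /\
  (* onto S_n(321) *)
  (forall t, is_perm n t -> avoids321 t ->
     exists s, [/\ is_perm n s, avoids231 s & Phi s = t]) /\
  (* equidistribution *)
  (forall s, is_perm n s -> avoids231 s ->
     (st_31_2 s, st_des s, st_ascinf s, st_lda s - st_fmax s, st_ldd s,
      st_lval s, st_lpk s, st_fmax s)
     = (st_icr (Phi s), st_drop (Phi s), st_exc (Phi s) + st_fix (Phi s),
        st_cda (Phi s), st_cdd (Phi s), st_cval (Phi s), st_cpk (Phi s),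
        st_fix (Phi s))
     /\
     (st_icr (Phi s), st_drop (Phi s), st_exc (Phi s) + st_fix (Phi s),
      st_cda (Phi s), st_cdd (Phi s), st_cval (Phi s), st_cpk (Phi s),
      st_fix (Phi s))
     = (st_cros (invp (Phi s)), st_exc (invp (Phi s)),
        st_drop (invp (Phi s)) + st_fix (invp (Phi s)),
        st_cdd (invp (Phi s)), st_cda (invp (Phi s)), st_cval (invp (Phi s)),
        st_cpk (invp (Phi s)), st_fix (invp (Phi s)))).
Proof.
split=> [s ps av|].
  have M := Phi_matches ps av; have [-> _ _] := M.
  by rewrite (matches_avoids321 M).
split; first exact: Phi_inj.
split; first exact: Phi_surj.
move=> s ps av; split; first exact: (Phi_stats ps av).
by have [pt _ _] := Phi_matches ps av; rewrite (inv_stats pt).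
Qed.
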